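(* Let $f,h:(0,\infty)\to[0,1]$ be any two functions. Then $$ \mathrm{dist}_{TV}\left(\mathrm{Law}(\{G_t(f)\}_{t\ge1}),\mathrm{Law}(\{G_t(h)\}_{t\ge1})\right)\le\|f-h\|_1, $$ where $\|f-h\|_1=\sum_{n=1}^\infty|f(n)-h(n)|$. In particular, if $f_n,f:(0,\infty)\to[0,1]$ ($n\in\mathbb{N}$) satisfy $\|f_n-f\|_1\to0$ as $n\to\infty$, then $\mathrm{Law}(\{G_t(f_n)\}_{t\ge1})\to\mathrm{Law}(\{G_t(f)\}_{t\ge1})$ in total variation distance.
   Context: Multigraphs may have loops and multiple edges; a loop contributes 2 to the degree of its vertex. For a finite connected multigraph $G$, $\pi_G$ is the probability distribution on its vertices $\pi_G(v)=\deg(v)/\sum_{w\in G}\deg(w)$. Process $G_t(f)$ for $f:(0,\infty)\to[0,1]$: let $(Z_t)_{t\ge1}$ be independent with $Z_t\sim\mathrm{Ber}(f(t))$. $G_0$ is one vertex with one self-loop. Given $G_t$ and independently of the past: if $Z_{t+1}=1$ (vertex-step), add a new vertex and connect it by one edge to a vertex of $G_t$ chosen according to $\pi_{G_t}$; if $Z_{t+1}=0$ (edge-step), add a new edge between two vertices of $G_t$ chosen independently, each according to $\pi_{G_t}$ (possibly creating a loop or a multiple edge). The result is $G_{t+1}$. $\mathrm{dist}_{TV}(\mu,\nu)=\sup_A|\mu(A)-\nu(A)|$, the supremum being over measurable sets of sequences of multigraphs (product $\sigma$-algebra). *)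

(* Defs.v *)
From HB Require Import structures.
From mathcomp Require Import all_boot all_order all_algebra.
From mathcomp Require Import finmap multiset.
From mathcomp Require Import all_classical all_reals all_analysis.

Set Implicit Arguments.
Unset Strict Implicit.
Unset Printing Implicit Defensive.

Import Order.TTheory GRing.Theory Num.Theory.
Import numFieldNormedType.Exports.

Local Open Scope mset_scope.
Local Open Scope classical_set_scope.
Local Open Scope ring_scope.

(* The edge joining u and v is the unordered pair {u, v}; a loop at v is the  *)
(* singleton {v}.                                                             *)
Definition edge (u v : nat) : {fset nat} := [fset u; v]%fset.

(* (n, E) : vertex set {0, ..., n - 1}, multiset of edges E *)
Definition is_multigraph (x : nat * {mset {fset nat}}) : bool :=
  all (fun e => [exists u : 'I_x.1, exists v : 'I_x.1, e == edge u v]) x.2.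

Record multigraph := Multigraph {
  multigraph_val : nat * {mset {fset nat}};
  multigraphP : is_multigraph multigraph_val
}.

HB.instance Definition _ := [isSub for multigraph_val].
HB.instance Definition _ := [Countable of multigraph by <:].

Definition nverts (G : multigraph) : nat := (multigraph_val G).1.
Definition edges (G : multigraph) : {mset {fset nat}} := (multigraph_val G).2.

Lemma loop_graph_subproof : is_multigraph (1%N, [mset edge 0 0]%mset).
Proof.
apply/allP => e; rewrite in_msetn /= => /eqP ->.
by apply/existsP; exists ord0; apply/existsP; exists ord0.
Qed.

Definition loop_graph : multigraph := Multigraph loop_graph_subproof.

Lemma add_leaf_subproof (G : multigraph) (u : 'I_(nverts G)) :
  is_multigraph ((nverts G).+1, edge u (nverts G) +` edges G)%mset.
Proof.
apply/allP => e; rewrite in_msetD in_msetn /= => /orP[/eqP ->|eG].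
  apply/existsP; exists (widen_ord (leqnSn _) u).
  by apply/existsP; exists ord_max.
have /existsP[a /existsP[b /eqP ->]] := allP (multigraphP G) e eG.
apply/existsP; exists (widen_ord (leqnSn _) a).
by apply/existsP; exists (widen_ord (leqnSn _) b).
Qed.

(* The new vertex gets the label nverts G: vertices are labelled in order of  *)
(* arrival.                                                                   *)
Definition add_leaf (G : multigraph) (u : 'I_(nverts G)) : multigraph :=
  Multigraph (add_leaf_subproof u).

Lemma add_edge_subproof (G : multigraph) (u v : 'I_(nverts G)) :
  is_multigraph (nverts G, edge u v +` edges G)%mset.
Proof.
apply/allP => e; rewrite in_msetD in_msetn /= => /orP[/eqP ->|eG].
  by apply/existsP; exists u; apply/existsP; exists v.
exact: (allP (multigraphP G) e eG).
Qed.

Definition add_edge (G : multigraph) (u v : 'I_(nverts G)) : multigraph :=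
  Multigraph (add_edge_subproof u v).

(* The sum runs over edges with multiplicity; a loop at v is counted twice.   *)
Definition deg (G : multigraph) (v : nat) : nat :=
  (\sum_(e <- edges G) ((v \in e) + (e == edge v v)))%N.

Definition deg_dist (R : realType) (G : multigraph) (v : 'I_(nverts G)) : R :=
  (deg G v)%:R / (\sum_(w < nverts G) deg G w)%:R.

(* Conditional probability that G_{t+1} = G' given G_t = G and Z_{t+1} = b.   *)
Definition step_prob (R : realType) (b : bool) (G G' : multigraph) : R :=
  if b then
    \sum_(u < nverts G | add_leaf u == G') deg_dist R u
  else
    \sum_(u < nverts G) \sum_(v < nverts G | add_edge u v == G')
      deg_dist R u * deg_dist R v.

HB.instance Definition _ := isPointed.Build multigraph loop_graph.
HB.instance Definition _ := @isMeasurable.Build default_measure_display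
  multigraph discrete_measurable discrete_measurable0
  discrete_measurableC discrete_measurableU.

(* The space of graph sequences with its product sigma-algebra, i.e. the one  *)
(* generated by the coordinate maps.                                          *)
Definition cylinders : set (set (nat -> multigraph)) :=
  \bigcup_t preimage_set_system setT (fun x => x t) measurable.

Definition graph_seq := g_sigma_algebraType cylinders.

Section process.
Context {R : realType}.
Local Open Scope ereal_scope.

Definition mutually_independent (I : choiceType) d (T : measurableType d)
    (P : probability T R) d' (T' : measurableType d')
    (X : I -> {RV P >-> T'}) : Prop :=
  forall (J : {fset I}) (B : I -> set T'), (forall i, measurable (B i)) ->
    P (\bigcap_(i in [set` J]) X i @^-1` B i) =
    \prod_(i <- J) P (X i @^-1` B i).

(* Indices are shifted for Z only: Z t is the Bernoulli variable of time      *)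
(* t + 1, which governs the step from G t to G t.+1.                          *)
Section realization.
Context d (T : measurableType d) (P : probability T R).
Variables (Z : nat -> {RV P >-> bool}) (G : nat -> {RV P >-> multigraph}).

Definition past (t : nat) (z : nat -> bool) (g : nat -> multigraph) : set T :=
  [set w | (forall s, (s < t)%N -> Z s w = z s) /\
           (forall s, (s <= t)%N -> G s w = g s)].

(* process_coin: Z_{t+1} is independent of (Z_1..Z_t, G_0..G_t).              *)
(* process_step: given that past and Z_{t+1}, G_{t+1} is drawn according to   *)
(* step_prob from G_t; in multiplied form, so that conditioning events of     *)
(* probability 0 need no exception.                                           *)
Record is_process (f : R -> R) : Prop := IsProcess {
  process_indep : mutually_independent Z;
  process_bernoulli : forall t (B : set bool),
    distribution P (Z t) B = bernoulli_prob (f t.+1%:R) B;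
  process_init : forall w, G 0%N w = loop_graph;
  process_coin : forall t z g b,
    P (past t z g `&` Z t @^-1` [set b]) =
    P (past t z g) * P (Z t @^-1` [set b]);
  process_step : forall t z g b g',
    P (past t z g `&` Z t @^-1` [set b] `&` G t.+1 @^-1` [set g']) =
    P (past t z g `&` Z t @^-1` [set b]) * (step_prob R b (g t) g')%:E
}.

End realization.

(* mu = Law({G_t(f)}_{t >= 1}); the coordinate k of a sequence is G_{k+1}.    *)
Definition is_law (f : R -> R) (mu : probability graph_seq R) : Prop :=
  exists d (T : measurableType d) (P : probability T R)
    (Z : nat -> {RV P >-> bool}) (G : nat -> {RV P >-> multigraph}),
    is_process Z G f /\
    forall A : set graph_seq, measurable A ->
      mu A = P ((fun w k => G k.+1 w) @^-1` A).

Definition dist_TV d (T : measurableType d) (mu nu : probability T R)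
    : \bar R :=
  ereal_sup [set `|mu A - nu A| | A in measurable].

Definition l1_norm (g : R -> R) : \bar R :=
  \sum_(1 <= n <oo) `|g n%:R|%:E.

(* A function (0, oo) -> [0, 1] is represented by any extension to R.         *)
Definition unit_valued (f : R -> R) : Prop :=
  forall x, (0 < x)%R -> (0 <= f x <= 1)%R.

End process.

(* Main.v *)
(* Replace, in the transition rules of the two processes, the probabilities   *)
(* f(t) and h(t) of a vertex-step by their minimum, and the probabilities     *)
(* 1 - f(t) and 1 - h(t) of an edge-step by theirs. The resulting weight of a *)
(* history is at most its probability under either law, and the weights of    *)
(* the histories of length n add up to prod_t (1 - |f(t) - h(t)|), which is   *)
(* at least 1 - sum_t |f(t) - h(t)|. So the two laws differ by at most        *)
(* ||f - h||_1 on every event that depends on finitely many graphs, and these *)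
(* events approximate every event, for the sum of both laws.                  *)

Require Import Defs.
From HB Require Import structures.
From mathcomp Require Import all_boot all_order all_algebra.
From mathcomp Require Import finmap multiset ring lra.
From mathcomp Require Import all_classical all_reals all_analysis.

Set Implicit Arguments.
Unset Strict Implicit.
Unset Printing Implicit Defensive.

Import Order.TTheory GRing.Theory Num.Theory.
Import numFieldNormedType.Exports.

Local Open Scope classical_set_scope.
Local Open Scope ring_scope.

(** Each step mixes a vertex kernel and an edge kernel that do not depend on [f]; only the mixing
    weights do. Hence the probability of a finite history is an explicit product ([process_weight]),
    and the comparison becomes one of finite sums ([ler_sum_weightB]). The common weight there is
    the mass that a coupling through maximally coupled coins would give to histories along which all
    coins agree; using it as a lower bound for both laws spares constructing the coupling.
    [law_history] carries the bound to events on finitely many graphs, and [sigma_algebra_approx]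
    extends it to all measurable events in [law_le]. *)

(** * Total mass of the transition probabilities *)

Lemma sum_fiber {R : nmodType} (I : finType) (T : eqType) (r : seq T)
    (h : I -> T) (F : I -> R) :
  uniq r -> (forall i, h i \in r) ->
  \sum_(y <- r) \sum_(i | h i == y) F i = \sum_i F i.
Proof.
move=> ur hr; rewrite (exchange_big_dep xpredT) //=.
apply: eq_bigr => i _; under eq_bigl do rewrite eq_sym.
by rewrite -big_filter filter_pred1_uniq // big_seq1.
Qed.

Lemma sum_deg_gt0 (G : multigraph) (e : {fset nat}) :
  e \in edges G -> (0 < \sum_(w < nverts G) deg G w)%N.
Proof.
move=> eG; have /existsP[u /existsP[v /eqP euv]] := allP (multigraphP G) e eG.
rewrite lt0n sum_nat_eq0; apply/forallPn; exists u.
rewrite /= -lt0n /deg; have : e \in (edges G : seq _) by [].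
move=> eE; rewrite (big_rem e) //= {1}euv /edge !inE eqxx /=.
by rewrite -addnA add1n.
Qed.

Lemma sum_deg_dist (R : realType) (G : multigraph) :
  (0 < \sum_(w < nverts G) deg G w)%N ->
  \sum_(u < nverts G) deg_dist R u = 1.
Proof.
by move=> G0; rewrite -mulr_suml -natr_sum divff // pnatr_eq0 -lt0n.
Qed.

Lemma deg_dist_ge0 (R : realType) (G : multigraph) (u : 'I_(nverts G)) :
  0 <= deg_dist R u.
Proof. by rewrite divr_ge0. Qed.

Lemma step_prob_ge0 (R : realType) b (G G' : multigraph) :
  0 <= step_prob R b G G'.
Proof.
case: b => /=; apply: sumr_ge0 => u _; first exact: deg_dist_ge0.
by apply: sumr_ge0 => v _; rewrite mulr_ge0 ?deg_dist_ge0.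
Qed.

(** Duplicates are removed because different choices of endpoints may give the same graph, and
    [step_prob] already adds up all choices leading to it. *)
Definition successors (G : multigraph) : seq multigraph :=
  undup ([seq add_leaf u | u : 'I_(nverts G)] ++
         [seq add_edge p.1 p.2 | p : 'I_(nverts G) * 'I_(nverts G)]).

Lemma successors_sum_deg_gt0 (G G' : multigraph) :
  G' \in successors G -> (0 < \sum_(w < nverts G') deg G' w)%N.
Proof.
rewrite mem_undup mem_cat => /orP[] /mapP[u _ ->].
  by apply: (@sum_deg_gt0 _ (edge u (nverts G)));
    rewrite in_msetD in_msetn eqxx.
by apply: (@sum_deg_gt0 _ (edge u.1 u.2)); rewrite in_msetD in_msetn eqxx.
Qed.

(** Grouping the endpoint choices by the resulting graph recovers the total mass of [deg_dist], or
    of its square. A positive total degree keeps the denominator of [deg_dist] nonzero. *)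
Lemma sum_step_prob (R : realType) b (G : multigraph) :
  (0 < \sum_(w < nverts G) deg G w)%N ->
  \sum_(G' <- successors G) step_prob R b G G' = 1.
Proof.
move=> G0; case: b => /=.
  rewrite sum_fiber ?undup_uniq ?sum_deg_dist // => u.
  by rewrite mem_undup mem_cat map_f ?mem_enum.
under eq_bigr do rewrite pair_big_dep /=.
rewrite (@sum_fiber _ _ _ _ (fun p => add_edge p.1 p.2)) ?undup_uniq //.
  rewrite -(pair_bigA _ (fun u v => deg_dist R u * deg_dist R v)) /=.
  under eq_bigr do rewrite -mulr_sumr sum_deg_dist // mulr1.
  exact: sum_deg_dist.
move=> p; rewrite mem_undup mem_cat orbC.
by rewrite (map_f (fun p => add_edge p.1 p.2)) ?mem_enum.
Qed.

(** * Finite histories and their weights *)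

(* Histories are listed backwards: [:: G_n; ...; G_1], with G_0 omitted, so   *)
(* that head loop_graph is the current state and size the current time.       *)
Fixpoint histories (n : nat) : seq (seq multigraph) :=
  if n is m.+1 then
    [seq G :: s | s <- histories m, G <- successors (head loop_graph s)]
  else [:: [::]].

Lemma size_histories n s : s \in histories n -> size s = n.
Proof.
elim: n s => [|n IH] s /=; first by rewrite inE => /eqP ->.
by move=> /allpairsPdep[s' [G [/IH <- _ ->]]].
Qed.

Lemma histories_uniq n : uniq (histories n).
Proof.
elim: n => [//|n IH]; apply: allpairs_uniq_dep => //.
  by move=> s _; exact: undup_uniq.
by move=> [s1 G1] [s2 G2] _ _ /= [-> ->].
Qed.

Lemma histories_sum_deg_gt0 n s : s \in histories n ->
  (0 < \sum_(w < nverts (head loop_graph s)) deg (head loop_graph s) w)%N.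
Proof.
case: n => [|n] /=.
  rewrite inE => /eqP -> /=.
  by apply: (@sum_deg_gt0 _ (edge 0 0)); rewrite in_msetn eqxx.
by move=> /allpairsPdep[s' [G [_ GS ->]]] /=; exact: successors_sum_deg_gt0 GS.
Qed.

(* For a t = f(t+1) and c t = 1 - f(t+1) this is the law of (G_1, ..., G_n);  *)
(* other choices of a and c give the common part of two such laws.            *)
Fixpoint weight (R : realType) (a c : nat -> R) (s : seq multigraph) : R :=
  if s is G :: s' then
    weight a c s' *
    (a (size s') * step_prob R true (head loop_graph s') G +
     c (size s') * step_prob R false (head loop_graph s') G)
  else 1.
Arguments weight {R} _ _ !_ /.
Arguments step_prob : simpl never.

(** Summing over the newest graph first, both kernels integrate to 1 and leave the factor
    [a t + c t]. *)
Lemma sum_weight (R : realType) (a c : nat -> R) n :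
  \sum_(s <- histories n) weight a c s = \prod_(t < n) (a t + c t).
Proof.
elim: n => [|n IH]; first by rewrite big_seq1 big_ord0.
rewrite [histories _]/= big_allpairs_dep big_ord_recr /= -IH mulr_suml.
apply: eq_big_seq => s sn.
rewrite -mulr_sumr big_split /= -!mulr_sumr.
rewrite !sum_step_prob ?(histories_sum_deg_gt0 sn) //.
by rewrite (size_histories sn) !mulr1.
Qed.

Lemma weight_ge0 (R : realType) (a c : nat -> R) s :
  (forall t, 0 <= a t) -> (forall t, 0 <= c t) -> 0 <= weight a c s.
Proof.
move=> a0 c0; elim: s => //= G s IH.
by rewrite mulr_ge0 ?addr_ge0 ?mulr_ge0 ?step_prob_ge0.
Qed.

Lemma ler_weight (R : realType) (a a' c c' : nat -> R) s :
  (forall t, 0 <= a t <= a' t) -> (forall t, 0 <= c t <= c' t) ->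
  weight a c s <= weight a' c' s.
Proof.
move=> aa' cc'; elim: s => //= G s IH.
have [/andP[? ?] /andP[? ?]] := (aa' (size s), cc' (size s)).
apply: ler_pM => //.
- by apply: weight_ge0 => t; [case/andP: (aa' t)|case/andP: (cc' t)].
- by rewrite addr_ge0 ?mulr_ge0 ?step_prob_ge0.
- by rewrite lerD ?ler_wpM2r ?step_prob_ge0.
Qed.

(** The Weierstrass product inequality, or the union bound for independent disagreements of
    probability [d t]. *)
Lemma ler_sum_1Bprod (R : realType) (d : nat -> R) n :
  (forall t, 0 <= d t <= 1) ->
  1 - \prod_(t < n) (1 - d t) <= \sum_(t < n) d t.
Proof.
move=> d01; elim: n => [|n IH]; first by rewrite !big_ord0 subrr.
rewrite !big_ord_recr /=.
have /andP[p0 p1] : 0 <= \prod_(i < n) (1 - d i) <= 1.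
  apply/andP; split.
    by apply: prodr_ge0 => i _; rewrite subr_ge0; case/andP: (d01 i).
  apply: prodr_ile1 => // i _; have /andP[? ?] := d01 i.
  by apply/andP; split; lra.
have /andP[? ?] := d01 n; nra.
Qed.

(** * The common part of two laws of histories *)

Section common_part.
Context {R : realType}.
Variables (p q : nat -> R).
Hypotheses (p01 : forall t, 0 <= p t <= 1) (q01 : forall t, 0 <= q t <= 1).

Let common := weight (fun t => Num.min (p t) (q t))
                     (fun t => Num.min (1 - p t) (1 - q t)).

(** On [B] the difference is at most the excess of the first weight over [common]. This excess is
    nonnegative, so its sum over [B] is at most its sum over all histories, which is one minus a
    product. *)
Lemma ler_sum_weightB n (B : pred (seq multigraph)) :
  \sum_(s <- histories n | B s) weight p (fun t => 1 - p t) s -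
  \sum_(s <- histories n | B s) weight q (fun t => 1 - q t) s <=
  \sum_(t < n) `|p t - q t|.
Proof.
have cp s : common s <= weight p (fun t => 1 - p t) s.
  apply: ler_weight => t; have := p01 t; have := q01 t;
    rewrite ge_min lexx le_min; lra.
have cq s : common s <= weight q (fun t => 1 - q t) s.
  apply: ler_weight => t; have := p01 t; have := q01 t;
    rewrite ge_min lexx orbT le_min; lra.
apply: le_trans (@ler_sum_1Bprod _ (fun t => `|p t - q t|) n _); last first.
  by move=> t; have := p01 t; have := q01 t; rewrite normr_ge0 ler_norml; lra.
have -> : 1 - \prod_(t < n) (1 - `|p t - q t|) =
  \sum_(s <- histories n) weight p (fun t => 1 - p t) s -
  \sum_(s <- histories n) common s.
  rewrite !sum_weight; congr (_ - _).
    by rewrite big1 // => t _; rewrite subrKC.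
  (* Factor by factor, min(p, q) + min(1 - p, 1 - q) = 1 - |p - q|. *)
  apply: eq_bigr => t _.
  case: (leP (p t) (q t)) => pq; case: leP => ?;
    first [rewrite ler0_norm; lra | rewrite gtr0_norm; lra | lra].
rewrite -!sumrB [X in _ <= X](bigID B) /= -[X in X <= _]addr0 lerD //.
  by apply: ler_sum => s _; rewrite lerD2l lerN2 cq.
by apply: sumr_ge0 => s _; rewrite subr_ge0.
Qed.

End common_part.

(** * The law of the first graphs of a process *)

Definition history (n : nat) (x : nat -> multigraph) : seq multigraph :=
  rev (mkseq x n).

Lemma historyS n x : history n.+1 x = x n :: history n x.
Proof. by rewrite /history mkseqS rev_rcons. Qed.

Lemma size_history n x : size (history n x) = n.
Proof. by rewrite size_rev size_mkseq. Qed.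

Lemma eq_historyP n x y :
  history n x = history n y <-> forall t, (t < n)%N -> x t = y t.
Proof.
elim: n => [//|n [IH IH']]; rewrite !historyS; split.
  by move=> [xy /IH H] t; rewrite ltnS leq_eqVlt => /orP[/eqP -> //|/H].
move=> H; rewrite H // IH' // => t tn; exact/H/ltnW.
Qed.

Lemma history_surj n s : size s = n ->
  history n (fun t => nth loop_graph (rev s) t) = s.
Proof. by move=> <-; rewrite /history -size_rev mkseq_nth revK. Qed.

Section process_law.
Context {R : realType} d (T : measurableType d) (P : probability T R).
Variables (Z : nat -> {RV P >-> bool}) (G : nat -> {RV P >-> multigraph}).

Local Open Scope ereal_scope.

Lemma probability_splitb (X : {RV P >-> bool}) (A : set T) : measurable A ->
  P A = P (A `&` X @^-1` [set true]) + P (A `&` X @^-1` [set false]).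
Proof.
move=> mA; have mX b : measurable (X @^-1` [set b]) by exact: measurable_funPTI.
rewrite (measureDI P mA (mX true)) addeC; congr (_ + P _).
by apply/seteqP; split=> w /= [Aw]; case: (X w).
Qed.

(* Interpolates between past t z g (k = 0) and the event that only constrains *)
(* G_0, ..., G_t (k = t).                                                     *)
Definition late_past (k t : nat) (z : nat -> bool) (g : nat -> multigraph) :
    set T :=
  [set w | (forall s, (k <= s < t)%N -> Z s w = z s) /\
           (forall s, (s <= t)%N -> G s w = g s)].

Lemma measurable_late_past k t z g : measurable (late_past k t z g).
Proof.
rewrite (_ : late_past k t z g =
    \bigcap_(s in [set s | (k <= s < t)%N]) (Z s @^-1` [set z s]) `&`
    \bigcap_(s in [set s | (s <= t)%N]) (G s @^-1` [set g s])); last first.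
  by apply/seteqP; split=> w [h1 h2]; split => s /=; [exact: h1|exact: h2|
    exact: h1|exact: h2].
by apply: measurableI; apply: bigcap_measurableType => s _;
  exact: measurable_funPTI.
Qed.

Lemma late_past_splitb k t z g b : (k < t)%N ->
  late_past k t (fun s => if s == k then b else z s) g =
  late_past k.+1 t z g `&` Z k @^-1` [set b].
Proof.
move=> kt; apply/seteqP; split=> w /=.
  move=> [hZ hG]; split; last first.
    by have := hZ k; rewrite eqxx leqnn kt; exact.
  split=> // s /andP[ks st]; have := hZ s.
  by rewrite (ltnW ks) st gtn_eqF //; exact.
move=> [[hZ hG] zk]; split=> // s /andP[ks st].
have [-> //|sk] := eqVneq s k.
by apply: hZ; rewrite st andbT ltn_neqAle eq_sym sk.
Qed.

Variable f : R -> R.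
Hypotheses (f01 : unit_valued f) (ZG : is_process Z G f).

Let f_ t := f t.+1%:R.

Lemma coin01 t : (0 <= f_ t <= 1)%R.
Proof. by apply: f01; rewrite ltr0n. Qed.

Lemma probability_coin t b :
  P (Z t @^-1` [set b]) = (if b then f_ t else 1 - f_ t)%:E.
Proof.
have := process_bernoulli ZG t [set b].
rewrite /distribution /pushforward => ->.
rewrite bernoulli_probE ?coin01 // !diracE.
have inE b' : (b' \in [set b]) = (b' == b).
  by apply/idP/eqP => [/set_mem //|->]; exact: mem_set.
by rewrite !inE; case: b {inE} => /=; rewrite mule1 mule0 ?adde0 ?add0e.
Qed.

(** The identity is linear in the past event, so the coins before time [k] can be summed out one at
    a time, starting from the full past. *)
Lemma late_past_step k t z g b g' :
  P (late_past k t z g `&` Z t @^-1` [set b] `&` G t.+1 @^-1` [set g']) =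
  P (late_past k t z g) * P (Z t @^-1` [set b]) * (step_prob R b (g t) g')%:E.
Proof.
elim: k z => [|k IH] z.
  (* [late_past 0] is convertible to [past]. *)
  by rewrite -(process_coin ZG) -(process_step ZG).
have mG : measurable (G t.+1 @^-1` [set g']) by exact: measurable_funPTI.
have mZ : measurable (Z t @^-1` [set b]) by exact: measurable_funPTI.
have mL := measurable_late_past k.+1 t z g.
(* If [t <= k], no coin is constrained by either event, and the two coincide. *)
have [kt|tk] := ltnP k t; last first.
  rewrite (_ : late_past k.+1 t z g = late_past k t z g) ?IH //.
  apply/seteqP; split=> w [_ hG]; split=> // s /andP[ks st];
    by move: (leq_ltn_trans ks st); rewrite ltnNge ?tk // ltnW.
rewrite (probability_splitb (Z k)); last by do 2 apply: measurableI => //.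
rewrite [in RHS](probability_splitb (Z k)) //.
have swap b0 : late_past k.+1 t z g `&` Z t @^-1` [set b] `&`
    G t.+1 @^-1` [set g'] `&` Z k @^-1` [set b0] =
  late_past k.+1 t z g `&` Z k @^-1` [set b0] `&` Z t @^-1` [set b] `&`
    G t.+1 @^-1` [set g'].
  by rewrite setIAC (setIAC (late_past _ _ _ _)).
rewrite !swap.
rewrite -!late_past_splitb // !IH.
by rewrite ge0_muleDl // ge0_muleDl ?mule_ge0 ?lee_fin ?step_prob_ge0.
Qed.

Lemma process_weight n x :
  P ((fun w t => G t.+1 w) @^-1` (history n @^-1` [set history n x])) =
  (weight f_ (fun t => 1 - f_ t)%R (history n x))%:E.
Proof.
elim: n => [|n IH].
  rewrite /= (_ : _ @^-1` _ = setT) ?probability_setT //.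
  by apply/seteqP; split.
(* Coordinate [t'] of a sequence is the graph at time [t'.+1]; [g] restores the initial graph. *)
pose g t := if t is t'.+1 then x t' else loop_graph.
have gE : head loop_graph (history n x) = g n.
  by case: n {IH} => //= n; rewrite historyS.
(* With both bounds equal to [m] no coin is constrained, so [xpredT] is an arbitrary filler. *)
have pastE m : (fun w t => G t.+1 w) @^-1` (history m @^-1` [set history m x]) =
    late_past m m xpredT g.
  apply/seteqP; split=> w /=.
    move=> /eq_historyP hw; split=> [s|[|s] sm]; rewrite ?(process_init ZG) //.
      by move=> /andP[] /leq_ltn_trans/[apply]; rewrite ltnn.
    exact: hw.
  by move=> [_ hw]; apply/eq_historyP => t tm; exact: (hw t.+1).
rewrite historyS /= gE size_history.
have -> : (fun w t => G t.+1 w) @^-1`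
      (history n.+1 @^-1` [set x n :: history n x]) =
    late_past n n xpredT g `&` G n.+1 @^-1` [set x n].
  rewrite -pastE; apply/seteqP; split=> w /=; rewrite historyS.
    by move=> [-> ->].
  by move=> [-> ->].
rewrite (probability_splitb (Z n)); last first.
  by apply: measurableI; [exact: measurable_late_past|exact: measurable_funPTI].
rewrite (setIAC (late_past _ _ _ _) _ (Z n @^-1` [set true])).
rewrite (setIAC (late_past _ _ _ _) _ (Z n @^-1` [set false])).
rewrite !late_past_step !probability_coin -pastE IH.
by rewrite -!EFinM -EFinD; congr EFin; ring.
Qed.

End process_law.

(** * Approximation of measurable sets by an algebra *)

(** The sets [A] that can be approximated form a sigma-algebra containing [C]. For countable unions,
    finiteness of [mu] gives continuity from above, so that a finite union already comes within
    [e / 2]. *)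
Lemma sigma_algebra_approx {R : realType} (T : pointedType)
    (C F : set (set T)) (mu : {measure set (g_sigma_algebraType C) -> \bar R}) :
  (mu setT < +oo)%E ->
  C `<=` F -> F `<=` <<s C >> -> F set0 ->
  (forall A, F A -> F (~` A)) -> (forall A B, F A -> F B -> F (A `|` B)) ->
  forall A, <<s C >> A -> forall e : R, 0 < e ->
  exists2 B, F B & (mu (A `+` B) < e%:E)%E.
Proof.
move=> muoo CF FC F0 FN FU.
pose D (A : set T) := <<s C >> A /\
  forall e : R, 0 < e -> exists2 B, F B & (mu (A `+` B) < e%:E)%E.
have mY (A B : set (g_sigma_algebraType C)) : measurable A -> measurable B ->
    measurable (A `+` B).
  by move=> mA mB; apply: measurableU; exact: measurableD.
have FD A : F A -> D A.
  move=> FA; split; first exact: FC.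
  by move=> e e0; exists A => //; rewrite setYK measure0 lte_fin.
have DU A B : D A -> D B -> D (A `|` B).
  move=> [mA hA] [mB hB]; split.
    exact: (@measurableU _ (g_sigma_algebraType C)).
  move=> e e0; have e20 : 0 < e / 2 by rewrite divr_gt0.
  have [A' FA' AA'] := hA _ e20; have [B' FB' BB'] := hB _ e20.
  exists (A' `|` B'); first exact: FU.
  have [mA' mB'] := (FC _ FA', FC _ FB').
  apply: (@le_lt_trans _ _ (mu ((A `+` A') `|` (B `+` B')))).
    apply: le_measure; rewrite ?inE.
    - by apply: mY; exact: measurableU.
    - by apply: measurableU; exact: mY.
    - move=> x [[[Ax|Bx] /not_orP[nA nB]]|[[Ax|Bx] /not_orP[nA nB]]];
        by [left; left|right; left|left; right|right; right].
  apply: (le_lt_trans (measureU2 _ _ _)); [exact: mY|exact: mY|].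
  by rewrite [e]splitr EFinD lteD.
suff : <<s C >> `<=` D by move=> CD A /CD[].
apply: smallest_sub => [|A CA]; last exact/FD/CF.
split.
- exact: FD.
- move=> A [mA hA]; rewrite setTD; split.
    exact: (@measurableC _ (g_sigma_algebraType C)).
  move=> e /hA[B FB AB]; exists (~` B); first exact: FN.
  rewrite (_ : _ `+` _ = A `+` B) //.
  by rewrite /setY !setDE !setCK setUC setIC (setIC B).
- move=> A DA.
  have mA i : measurable (A i : set (g_sigma_algebraType C)) by case: (DA i).
  have mU : measurable (\bigcup_i A i : set (g_sigma_algebraType C)).
    exact: bigcupT_measurable.
  split=> // e e0; have e20 : 0 < e / 2 by rewrite divr_gt0.
  pose U n : set (g_sigma_algebraType C) := \big[setU/set0]_(i < n) A i.
  have DUn n : D (U n).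
    by rewrite /U; elim/big_ind : _ => //; exact: FD.
  have mUn n : measurable (U n) by case: (DUn n).
  have [n Un] : exists n, (mu (\bigcup_i A i `\` U n) < (e / 2)%:E)%E.
    have cap0 : \bigcap_n (\bigcup_i A i `\` U n) = set0.
      apply/seteqP; split=> // x h; have [[i _ Aix] _] := h 0%N I.
      have [_] := h i.+1 I; apply.
      by rewrite /U big_ord_recr /=; right.
    have : mu (\bigcup_i A i `\` U n) @[n --> \oo] -->
        mu (\bigcap_n (\bigcup_i A i `\` U n)).
      apply: nonincreasing_cvg_mu.
      - apply: le_lt_trans muoo; apply: le_measure; rewrite ?inE //.
        exact: measurableD.
      - by move=> n; exact: measurableD.
      - by rewrite cap0.
      - move=> n m nm; apply/subsetPset; apply: setDS.
        by rewrite /U; exact: subset_bigsetU.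
    rewrite cap0 measure0 => /(_ [set y | (y < (e / 2)%:E)%E]) h.
    have [|N _ hN] := h.
      by apply: open_ereal_lt'; rewrite lte_fin.
    by exists N; apply: hN => /=.
  have [_ /(_ _ e20)[B FB UB]] := DUn n; have mB := FC _ FB.
  exists B => //.
  apply: (@le_lt_trans _ _ (mu ((\bigcup_i A i `\` U n) `|` (U n `+` B)))).
    apply: le_measure; rewrite ?inE.
    - exact: mY.
    - by apply: measurableU; [exact: measurableD|exact: mY].
    - move=> x [[Ax nB]|[Bx nA]].
        by have [Ux|nU] := pselect (U n x); [right; left|left].
      by right; right; split => // Ux; apply: nA; exact: bigsetU_bigcup Ux.
  apply: (le_lt_trans (measureU2 _ _ _)); [exact: measurableD|exact: mY|].
  by rewrite [e]splitr EFinD lteD.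
Qed.

(** * Comparison of the laws on graph sequences *)

(** There are countably many multigraphs, so splitting on the newest one is a countable union,
    whatever [B] is. *)
Lemma measurable_history n (B : set (seq multigraph)) :
  measurable (history n @^-1` B : set graph_seq).
Proof.
elim: n B => [|n IH] B.
  have [B0|B0] := pselect (B [::]).
    by rewrite (_ : _ @^-1` _ = setT) //; apply/seteqP; split.
  by rewrite (_ : _ @^-1` _ = set0) //; apply/seteqP; split.
rewrite (_ : _ @^-1` _ =
    \bigcup_G ((fun x : graph_seq => x n) @^-1` [set G] `&`
               history n @^-1` [set s | B (G :: s)])).
  apply: countable_bigcupT_measurable => // G.
  apply: measurableI; last exact: IH.
  apply: sub_sigma_algebra; exists n => //; exists [set G] => //.
  by rewrite setTI.
apply/seteqP; split=> x /=; rewrite historyS.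
  by exists (x n).
by move=> [G _ [/= <-]].
Qed.

Section law.
Context {R : realType}.
Implicit Types (f h : R -> R) (mu nu : probability graph_seq R).

Local Open Scope ereal_scope.

Lemma law_weight f mu n s : unit_valued f -> is_law f mu -> size s = n ->
  mu (history n @^-1` [set s]) =
  (weight (fun t => f t.+1%:R) (fun t => 1 - f t.+1%:R)%R s)%:E.
Proof.
move=> f01 [d [T [P [Z [G [ZG muE]]]]]] sn.
rewrite muE; last exact: measurable_history.
by rewrite -(history_surj sn) (process_weight f01 ZG).
Qed.

Lemma measure_history mu n (r : seq (seq multigraph))
    (B : pred (seq multigraph)) : uniq r ->
  mu (history n @^-1` [set s | B s && (s \in r)]) =
  \sum_(s <- r | B s) mu (history n @^-1` [set s]).
Proof.
elim: r => [_|s r IH /andP[sr ur]].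
  rewrite big_nil (_ : _ @^-1` _ = set0) ?measure0 //.
  by apply/seteqP; split=> // x /=; rewrite andbF.
rewrite big_cons -IH //; case: ifPn => Bs; last first.
  congr (mu _); apply/seteqP; split=> x /=; rewrite inE; last first.
    by move=> /andP[-> ->]; rewrite orbT.
  by case: eqP => [->|//]; rewrite (negbTE Bs).
rewrite -measureU; [|exact: measurable_history|exact: measurable_history|].
  congr (mu _); apply/seteqP; split=> x /=; rewrite inE.
    by move=> /andP[Bx /orP[/eqP|xr]]; [left|right; rewrite Bx].
  by move=> [->|/andP[-> ->]]; rewrite ?Bs ?eqxx ?orbT.
by apply/seteqP; split=> // x /= [->]; rewrite (negbTE sr) andbF.
Qed.

(* The histories outside histories n are null because the weights of those    *)
(* inside already add up to 1.                                                *)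
Lemma law_history f mu n (B : pred (seq multigraph)) :
  unit_valued f -> is_law f mu ->
  mu (history n @^-1` [set s | B s]) =
  (\sum_(s <- histories n | B s)
     weight (fun t => f t.+1%:R) (fun t => 1 - f t.+1%:R) s)%R%:E.
Proof.
move=> f01 fmu.
have inside C : mu (history n @^-1` [set s | C s && (s \in histories n)]) =
    (\sum_(s <- histories n | C s)
       weight (fun t => f t.+1%:R) (fun t => 1 - f t.+1%:R) s)%R%:E.
  rewrite measure_history ?histories_uniq // -sumEFin.
  rewrite !(big_seq_cond C); apply: eq_bigr => s /andP[sn _].
  by rewrite (law_weight f01 fmu (size_histories sn)).
have null : mu (history n @^-1` [set s | s \notin histories n]) = 0.
  rewrite (_ : _ @^-1` _ = ~` (history n @^-1`
      [set s | xpredT s && (s \in histories n)])); last first.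
    by apply/seteqP; split=> x /=; move/negP.
  rewrite probability_setC ?inside; last exact: measurable_history.
  rewrite sum_weight big1 => [|t _]; last by rewrite subrKC.
  by rewrite subee.
rewrite -inside; apply/eqP; rewrite eq_le; apply/andP; split; last first.
  apply: le_measure; rewrite ?inE; [exact: measurable_history..|].
  by move=> x /= /andP[].
rewrite -[leRHS]adde0 -[X in _ + X]null.
apply: le_trans (measureU2 _ _ _); [|exact: measurable_history..].
apply: le_measure; rewrite ?inE.
- exact: measurable_history.
- by apply: measurableU; exact: measurable_history.
- by move=> x /= Bx; case: (boolP (history n x \in histories n)) => ?;
    [left; rewrite Bx|right].
Qed.

Lemma l1_normC f h : l1_norm (f \- h)%R = l1_norm (h \- f)%R.
Proof.
by congr (limn _); apply/funext => n; apply: eq_bigr => i _; rewrite /= distrC.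
Qed.

Lemma law_le_history f h mu nu n (B : pred (seq multigraph)) :
  unit_valued f -> unit_valued h -> is_law f mu -> is_law h nu ->
  mu (history n @^-1` [set s | B s]) <=
  nu (history n @^-1` [set s | B s]) + l1_norm (f \- h)%R.
Proof.
move=> f01 h01 fmu hnu.
rewrite (law_history _ _ f01 fmu) (law_history _ _ h01 hnu).
have H t : (0 <= f t.+1%:R <= 1)%R by apply: f01; rewrite ltr0n.
have H' t : (0 <= h t.+1%:R <= 1)%R by apply: h01; rewrite ltr0n.
have := ler_sum_weightB H H' n B.
rewrite lerBlDl -lee_fin EFinD => /le_trans; apply.
apply: leeD2l.
(* The series starts at 1, so its first [n] terms end before [n.+1]. *)
apply: le_trans (@nneseries_lim_ge _ _ xpredT 1%N n.+1 _); last first.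
  by move=> m _ _; rewrite lee_fin.
by rewrite big_add1 /= big_mkord -sumEFin.
Qed.

(** An event [X] on finitely many graphs that is close to [A] for [mu + nu] is close for both laws
    at once: passing from [A] to [X] under [mu] and back under [nu] costs less than [e] in total. *)
Lemma law_le f h mu nu A :
  unit_valued f -> unit_valued h -> is_law f mu -> is_law h nu ->
  measurable A -> mu A <= nu A + l1_norm (f \- h)%R.
Proof.
move=> f01 h01 fmu hnu mA; apply/lee_addgt0Pr => e e0.
pose F : set (set graph_seq) :=
  [set X | exists n (B : pred (seq multigraph)),
    X = history n @^-1` [set s | B s]].
have FC X : F X -> measurable X by move=> [n [B ->]]; exact: measurable_history.
(* Brings two events to a common length, for unions; histories run backwards, so dropping the first
   [m] entries forgets the latest graphs. *)
have widen n m (B : pred (seq multigraph)) : history n @^-1` [set s | B s] =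
    history (m + n) @^-1` [set s | B (drop m s)].
  elim: m => [|m IH]; first by apply/seteqP; split=> x /=; rewrite drop0.
  by rewrite IH; apply/seteqP; split=> x /=; rewrite historyS.
pose m : {measure set graph_seq -> \bar R} := measure_add mu nu.
have mE X : m X = mu X + nu X := measure_addE mu nu X.
have [] := @sigma_algebra_approx R _ cylinders F m
    _ _ FC _ _ _ _ mA _ e0.
- by rewrite mE !probability_setT ltry.
- move=> X [t _ [Y _ <-]]; exists t.+1, (fun s => `[< Y (head loop_graph s) >]).
  by rewrite setTI; apply/seteqP; split=> x /=; rewrite historyS => /asboolP.
- by exists 0%N, pred0; apply/seteqP; split.
- move=> X [n [B ->]]; exists n, (predC B).
  by apply/seteqP; split=> x /= /negP.
- move=> X Y [n [B ->]] [k [C ->]]; exists (k + n)%N.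
  exists (fun s => B (drop k s) || C (drop n s)).
  rewrite (widen n k) (widen k n) addnC.
  by apply/seteqP; split=> x /= /orP.
move=> _ [n [B ->]]; pose X : set graph_seq := history n @^-1` [set s | B s].
move=> AX; have {}AX : m (A `+` X) < e%:E := AX.
have mX : measurable X by exact: measurable_history.
have mAX : measurable (A `+` X) by apply: measurableU; exact: measurableD.
have symdiff (p : probability graph_seq R) (U V : set graph_seq) :
    measurable U -> measurable V -> p U <= p V + p (U `+` V).
  move=> mU mV; have mUV : measurable (U `+` V).
    by apply: measurableU; exact: measurableD.
  apply: le_trans (measureU2 _ mV mUV).
  apply: le_measure; rewrite ?inE //; first exact: measurableU.
  by move=> x Ux; have [Vx|Vx] := pselect (V x); [left|right; left].
apply: (le_trans (symdiff mu A X mA mX)).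
apply: (le_trans (leeD2r _ (_ : mu X <= nu X + l1_norm (f \- h)%R))).
  exact: law_le_history.
apply: (le_trans (leeD2r _ (leeD2r _ (symdiff nu X A mX mA)))).
rewrite [X `+` A]setUC -/(setY A X) -!addeA leeD2l // addeCA leeD2l //.
by rewrite addeC -mE; exact: ltW.
Qed.

Lemma dist_TV_le f h mu nu :
  unit_valued f -> unit_valued h -> is_law f mu -> is_law h nu ->
  dist_TV mu nu <= l1_norm (f \- h)%R.
Proof.
move=> f01 h01 fmu hnu; apply: ge_ereal_sup => _ [A mA <-].
have muA := fin_num_measure mu A mA; have nuA := fin_num_measure nu A mA.
have H1 := law_le f01 h01 fmu hnu mA.
have H2 := law_le h01 f01 hnu fmu mA; rewrite l1_normC in H2.
have [le_nm|/ltW le_mn] := leP (nu A) (mu A).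
  by rewrite gee0_abs ?leeBlDl // sube_ge0 ?nuA.
rewrite lee0_abs; last by rewrite sube_le0 ?nuA.
by rewrite fin_num_oppeB // addeC leeBlDl.
Qed.
End law.

Theorem theorem4 (R : realType) :
  (forall f h : R -> R, unit_valued f -> unit_valued h ->
     forall mu nu : probability graph_seq R, is_law f mu -> is_law h nu ->
       (dist_TV mu nu <= l1_norm (f \- h)%R)%E) /\
  (forall (f_ : nat -> R -> R) (f : R -> R),
     (forall n, unit_valued (f_ n)) -> unit_valued f ->
     l1_norm (f_ n \- f) @[n --> \oo] --> 0%E ->
     forall (mu_ : nat -> probability graph_seq R)
       (mu : probability graph_seq R),
       (forall n, is_law (f_ n) (mu_ n)) -> is_law f mu ->
       dist_TV (mu_ n) mu @[n --> \oo] --> 0%E).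
Proof.
split=> [f h f01 h01 mu nu|f_ f f_01 f01 f_f mu_ mu f_mu_ fmu].
  exact: dist_TV_le.
apply: (squeeze_cvge _ (cvg_cst 0%E) f_f); near=> n; apply/andP; split.
  (* The empty event contributes the value 0 to the supremum. *)
  by apply: ereal_sup_ubound; exists set0 => //; rewrite !measure0 subee ?abse0.
exact: dist_TV_le (f_01 n) f01 (f_mu_ n) fmu.
Unshelve. all: by end_near. Qed.
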